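(* Let $X$ be a real Hausdorff locally convex space, let $\tau$ be a locally convex topology on $X^{\ast}$ with $\sigma(X^{\ast},X)\subset\tau\subset\beta(X^{\ast},X)$, and let $X^{\ast\ast}:=(X^{\ast},\tau)^{\ast}$. Let $f,g:X\rightarrow\mathbb{R}\cup\{+\infty\}$ be convex functions each having a continuous affine minorant. If $f$ is (finite and) continuous at some point of $\operatorname{dom}g$, then, for all $x\in X^{\ast\ast}$ and $\varepsilon\geq 0$, $$\partial_{\varepsilon}\big(\overline{f+g}^{w^{\ast\ast}}\big)(x)=\partial_{\varepsilon}\big(\overline{f}^{w^{\ast\ast}}+\overline{g}^{w^{\ast\ast}}\big)(x)=\bigcup_{\substack{\varepsilon_{1},\varepsilon_{2}\geq 0\\ \varepsilon_{1}+\varepsilon_{2}=\varepsilon}}\Big(\partial_{\varepsilon_{1}}\overline{f}^{w^{\ast\ast}}(x)+\partial_{\varepsilon_{2}}\overline{g}^{w^{\ast\ast}}(x)\Big).$$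
   Context: $X^{\ast}$ is the topological dual of $X$; $\sigma(X^{\ast},X)$ is the weak* topology and $\beta(X^{\ast},X)$ the strong topology. $X$ is identified with a linear subspace of $X^{\ast\ast}$, and $X^{\ast\ast}$ carries the topology $w^{\ast\ast}:=\sigma(X^{\ast\ast},X^{\ast})$, so that its topological dual is $X^{\ast}$. $\operatorname{dom}f:=\{x: f(x)<+\infty\}$. A continuous affine minorant of $f$ is a function $x\mapsto\langle x^{\ast},x\rangle+c\le f(x)$ with $x^{\ast}\in X^{\ast}$, $c\in\mathbb{R}$. For $f:X\to\mathbb{R}\cup\{+\infty\}$, $\overline{f}^{w^{\ast\ast}}:X^{\ast\ast}\to\mathbb{R}\cup\{\pm\infty\}$ is the $w^{\ast\ast}$-lower semicontinuous hull of the extension of $f$ by $+\infty$ to $X^{\ast\ast}\setminus X$, i.e. $\overline{f}^{w^{\ast\ast}}(x)=\sup_{U}\inf_{y\in(x+U)\cap X}f(y)$, the supremum being over a basis of $w^{\ast\ast}$-neighborhoods $U$ of the origin in $X^{\ast\ast}$. For $h:X^{\ast\ast}\to\mathbb{R}\cup\{\pm\infty\}$, $x\in X^{\ast\ast}$ and $\varepsilon\ge 0$, $\partial_{\varepsilon}h(x):=\{x^{\ast}\in X^{\ast}: h^{\ast}(x^{\ast})+h(x)\le\langle x,x^{\ast}\rangle+\varepsilon\}$, where $h^{\ast}(x^{\ast}):=\sup_{z\in X^{\ast\ast}}\{\langle z,x^{\ast}\rangle-h(z)\}$, with $\partial_{\varepsilon}h(x)=\emptyset$ if $h(x)\notin\mathbb{R}$.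 *)

(* Defs.v *)
From HB Require Import structures.
From mathcomp Require Import all_boot all_order all_algebra.
From mathcomp Require Import interval_inference.
From mathcomp Require Import all_classical all_reals.
From mathcomp Require Import ereal topology convex normedtype.

Set Implicit Arguments.
Unset Strict Implicit.
Unset Printing Implicit Defensive.

Import Order.TTheory GRing.Theory Num.Theory.
Import numFieldTopology.Exports numFieldNormedType.Exports.

Local Open Scope classical_set_scope.
Local Open Scope ring_scope.

(* A topology on T as a value (its family of open sets, as in the factory
   isOpenTopological) rather than as a canonical instance, so that several
   topologies on the same dual space can be quantified over and compared. *)
Record topology_on (T : Type) := TopologyOn {
  open_in : set_system T ;
  open_inT : open_in setT ;
  open_inI : setI_closed open_in ;
  open_in_bigU : forall (I : Type) (F : I -> set T),
    (forall i, open_in (F i)) -> open_in (\bigcup_i F i)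
}.

Definition with_topology (T : Type) (tau : topology_on T) : Type := T.

HB.instance Definition _ (T : choiceType) (tau : topology_on T) :=
  Choice.copy (with_topology tau) T.
HB.instance Definition _ (T : choiceType) (tau : topology_on T) :=
  isOpenTopological.Build (with_topology tau)
    (open_inT tau) (@open_inI _ tau) (@open_in_bigU _ tau).
HB.instance Definition _ (R : numDomainType) (E : lmodType R)
    (tau : topology_on E) :=
  GRing.Lmodule.copy (with_topology tau) E.

(* The three conditions are the fields of PreTopologicalLmod_isTvs. *)
Definition locally_convex_topology (R : numDomainType) (E : lmodType R)
    (tau : topology_on E) : Prop :=
  let W := with_topology tau in
  [/\ continuous (fun x : W * W => x.1 + x.2),
      continuous (fun z : R^o * W => z.1 *: z.2) &
      exists2 B : set_system W, (forall b, b \in B -> convex_set b) & basis B].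

Section dual.
Context {R : realType} (E : preTopologicalLmodType R).

Definition continuous_linear : {pred E -> R^o} :=
  mem [set f : E -> R^o | linear f /\ continuous f].
Definition continuous_linear_key : pred_key continuous_linear.
Proof. exact. Qed.
Canonical continuous_linear_keyed := KeyedPred continuous_linear_key.

Record dual : Type := Dual {
  dual_fun :> E -> R^o ;
  dual_funP : dual_fun \in continuous_linear
}.

HB.instance Definition _ := [isSub for dual_fun].
HB.instance Definition _ := [Choice of dual by <:].

Lemma continuous_linear_submod_closed : submod_closed continuous_linear.
Proof.
split; first by rewrite inE; split=> [a x y|x]; [rewrite scaler0 addr0 | exact: cvg_cst].
move=> a f g; rewrite !inE => -[lf cf] [lg cg]; split.
  move=> k x y; rewrite !fctE lf lg !scalerDr addrACA; congr (_ + _ + _).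
  by rewrite !scalerA mulrC.
move=> x; apply: (@cvgD R R^o); last exact: cg.
by apply: (@cvgZl_tmp R R^o); exact: cf.
Qed.

HB.instance Definition _ :=
  GRing.isSubmodClosed.Build R (E -> R^o) continuous_linear
    continuous_linear_submod_closed.
HB.instance Definition _ := [SubChoice_isSubLmodule of dual by <:].

End dual.

Section dual_topologies.
Context {R : realType} (E : preTopologicalLmodType R).

Definition dual_ptws (xs : dual E) : {ptws E -> R^o} := xs.

(* sigma(E^*, E): pointwise convergence *)
Definition weak_star := initial_topology dual_ptws.

(* von Neumann boundedness *)
Definition tvs_bounded (B : set E) : Prop :=
  forall U : set E, nbhs 0 U ->
    exists2 r : R, 0 < r & forall t : R, r <= t -> B `<=` *:%R t @` U.

Definition dual_unif_bounded (xs : dual E) : {family tvs_bounded, E -> R^o} :=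
  xs.

(* beta(E^*, E): uniform convergence on the bounded subsets of E *)
Definition strong_dual := initial_topology dual_unif_bounded.

End dual_topologies.

HB.instance Definition _ (R : realType) (E : preTopologicalLmodType R) :=
  Topological.on (weak_star E).
HB.instance Definition _ (R : realType) (E : preTopologicalLmodType R) :=
  Topological.on (strong_dual E).

Section bidual.
Context {R : realType} (X : tvsType R) (tau : topology_on (dual X)).

Definition bidual := dual (with_topology tau).
HB.instance Definition _ := GRing.Lmodule.on bidual.

(* X^{**} with w^{**} = sigma(X^{**}, X^* ) *)
Definition bidual_wss := weak_star (with_topology tau).
HB.instance Definition _ := Topological.on bidual_wss.

(* sigma(X^*, X) `<=` tau `<=` beta(X^*, X), as families of open sets *)
Definition weak_star_le := @open (weak_star X) `<=` open_in tau.
Definition le_strong_dual := open_in tau `<=` @open (strong_dual X).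

Definition evaluation (y : X) : with_topology tau -> R^o :=
  fun xs => (xs : dual X) y.

Lemma evaluation_dual (sigma_tau : weak_star_le) (y : X) :
  evaluation y \in @continuous_linear R (with_topology tau).
Proof.
rewrite inE; split=> //; apply/continuousP => A oA.
have cev : continuous (fun xs : weak_star X => (xs : dual X) y : R^o).
  move=> xs; apply: (@continuous_comp (weak_star X) {ptws X -> R^o} R^o
    (@dual_ptws R X) (fun f => f y)); first exact: initial_continuous.
  exact: (@proj_continuous X (fun=> R^o) y).
by apply: sigma_tau; move/continuousP: cev; apply.
Qed.

Definition canonical_embedding (sigma_tau : weak_star_le) (y : X) : bidual :=
  Dual (evaluation_dual sigma_tau y).

Local Open Scope ereal_scope.

(* y ranges over (x + U) `&` X, with X seen in X^{**} through the canonical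
   embedding. *)
Definition wss_lsc_hull (sigma_tau : weak_star_le) (f : X -> \bar R)
    (x : bidual) : \bar R :=
  ereal_sup [set ereal_inf
      [set f y | y in [set y | U (canonical_embedding sigma_tau y - x)%R]]
    | U in nbhs ((0%R : bidual) : bidual_wss)].

Definition conjugate (h : bidual -> \bar R) (xs : dual X) : \bar R :=
  ereal_sup [set (z xs)%:E - h z | z in [set: bidual]].

Definition subdifferential (eps : R) (h : bidual -> \bar R) (x : bidual) :
    set (dual X) :=
  [set xs | h x \is a fin_num /\ conjugate h xs + h x <= (x xs + eps)%:E].

End bidual.

Section extended_functions.
Context {R : realType} (X : tvsType R).
Local Open Scope ereal_scope.
Implicit Types f : X -> \bar R.

(* For f > -oo; with 0 < t < 1 the product 0 * +oo never occurs. *)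
Definition convex_efun f : Prop :=
  forall (x y : X) (t : R), (0 < t < 1)%R ->
    f (t *: x + (1 - t) *: y)%R <= t%:E * f x + (1 - t)%:E * f y.

Definition has_continuous_affine_minorant f : Prop :=
  exists (xs : dual X) (c : R), forall x, (xs x + c)%:E <= f x.

Definition edom f : set X := [set x | f x < +oo].

End extended_functions.

(* Main.v *)
Require Import Defs.
From mathcomp Require Import all_boot all_order all_algebra.
From mathcomp Require Import interval_inference ring lra.
From mathcomp Require Import all_classical all_reals.
From mathcomp Require Import ereal topology convex normedtype.

Set Implicit Arguments.
Unset Strict Implicit.
Unset Printing Implicit Defensive.

Import Order.TTheory GRing.Theory Num.Theory.
Import numFieldTopology.Exports numFieldNormedType.Exports.
Local Open Scope classical_set_scope.
Local Open Scope ring_scope.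

(** Write [F], [G], [H] for the hulls of [f], [g], [f + g], and [x xs] for the
    pairing of [x] in [X^**] with [xs] in [X^*].

    The value of a hull at [x] is determined by affine minorants.  On the one
    hand, if [a y + c <= h y] on [X], then [x a + c] is at most the hull of [h]
    at [x] ([hull_ge_affine]).  On the other hand, for [h] convex with a
    continuous affine minorant and finite somewhere, every real number strictly
    below the hull at [x] is the value at [x] of an affine minorant of [h] given
    by an element of [X^*] ([hull_gt_affine_minorant]).  This is the
    Fenchel-Moreau theorem for the duality between [X^**] and [X^*]; since a
    basic neighborhood of [x] involves finitely many functionals only, it reduces
    to a separation in a finite-dimensional space.

    The qualification condition enters through the Moreau-Rockafellar splitting
    ([sum_affine_minorant_split]): each continuous affine minorant of [f + g] is
    the sum of a continuous affine minorant of [f] and one of [g].  Together with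
    the two facts above it yields [H = F + G] pointwise ([wss_lsc_hullD]), whence
    the first equality.

    For the second equality, when [h x] is finite, [xs] is an [eps]-subgradient
    of [h] at [x] exactly when [h z >= h x + (z xs - x xs) - eps] for all [z]
    ([subdifferentialP]).  An [eps]-subgradient of [F + G] thus gives an affine
    minorant of [f + g]; its splitting gives affine minorants of [F] and [G]
    whose gaps at [x] are nonnegative and add up to at most [eps].  The other
    inclusion is the sum of two such inequalities.

    Both separations are instances of [convex_relation_ge_linear], a form of the
    Hahn-Banach theorem; it rests on the fact that a minimal sublinear functional
    is linear. *)

(** * Sublinear functionals and the Hahn-Banach theorem *)

Section hahn_banach.
Context {R : realType} {V : lmodType R}.
Implicit Types (p q : V -> R).

(** Subadditive and positively homogeneous real functionals.  Homogeneity is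
    asked for positive factors only; [p 0 = 0] follows ([sublinear0]). *)
Definition sublinear p : Prop :=
  (forall u v, p (u + v) <= p u + p v) /\
  (forall t v, 0 < t -> p (t *: v) = t * p v).

Lemma sublinear0 p : sublinear p -> p 0 = 0.
Proof.
by move=> [_ pZ]; have := pZ 2 0 (ltr0Sn _ _); rewrite scaler0; lra.
Qed.

Lemma sublinear_geN p v : sublinear p -> - p (- v) <= p v.
Proof.
move=> sp; have := sp.1 v (- v); rewrite subrr (sublinear0 sp); lra.
Qed.

(** Infima of chains of sublinear functionals dominated by [p] are again
    sublinear, so that Zorn's lemma yields minimal elements. *)
Lemma exists_minimal_sublinear p : sublinear p ->
  exists q, [/\ sublinear q, forall v, q v <= p v &
    forall r, sublinear r -> (forall v, r v <= q v) -> forall v, q v <= r v].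
Proof.
move=> sp.
pose T := {q : V -> R | sublinear q /\ forall v, q v <= p v}.
pose below (a b : T) := `[< forall v, sval b v <= sval a v >].
have [|a|a b c /asboolP ab /asboolP bc|A Atot|[q [sq qp]] qmin] :=
    @ZL_preorder T _ below.
- by exists p.
- exact/asboolP.
- by apply/asboolP => v; exact: le_trans (bc v) (ab v).
- have [[a0 Aa0]|A0] := pselect (A !=set0); last first.
    by exists (exist _ p (conj sp (fun=> lexx _))) => s As; case: A0; exists s.
  pose q v := inf [set sval a v | a in A].
  have lbA v : has_lbound [set sval a v | a in A].
    exists (- p (- v)) => _ [[a [sa ap]] _ <-] /=.
    by apply: le_trans (sublinear_geN v sa); rewrite lerN2.
  have qle a v : A a -> q v <= sval a v by move=> Aa; apply: ge_inf => //; exists a.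
  have qge v c : (forall a, A a -> c <= sval a v) -> c <= q v.
    move=> cA; apply: lb_le_inf; first by exists (sval a0 v), a0.
    by move=> _ [a Aa <-]; exact: cA.
  have sq : sublinear q.
    split=> [u v|t v t0]; last first.
      apply/eqP; rewrite eq_le; apply/andP; split; last first.
        apply: (qge) => a Aa; rewrite (svalP a).1.2// ler_pM2l//; exact: qle.
      rewrite -ler_pdivrMl//; apply: (qge) => a Aa.
      by rewrite ler_pdivrMl// -(svalP a).1.2//; exact: qle.
    rewrite -lerBlDr; apply: (qge) => a Aa; rewrite lerBlDr -lerBlDl.
    apply: (qge) => b Ab; rewrite lerBlDl.
    have [/asboolP ab|/asboolP ba] := Atot _ _ Aa Ab.
      apply: (le_trans (qle b _ Ab)); apply: (le_trans ((svalP b).1.1 u v)).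
      have := ab u; lra.
    apply: (le_trans (qle a _ Aa)); apply: (le_trans ((svalP a).1.1 u v)).
    have := ba v; lra.
  have qp v : q v <= p v.
    by apply: (le_trans (qle a0 v Aa0)); exact: (svalP a0).2.
  by exists (exist _ q (conj sq qp)) => a Aa; apply/asboolP => v; exact: qle.
- exists q; split=> // r sr rq.
  have rp v : r v <= p v by exact: le_trans (rq v) (qp v).
  have /(_ _)/asboolP := qmin (exist _ r (conj sr rp)).
  by apply; apply/asboolP.
Qed.

(** Replacing [q] by [v |-> inf_(t >= 0) (q (v + t w) - t q w)] gives a
    sublinear functional below [q]; minimality forces equality, whence
    [q (v + w) >= q v + q w]. *)
Lemma minimal_sublinear_additive q : sublinear q ->
  (forall r, sublinear r -> (forall v, r v <= q v) -> forall v, q v <= r v) ->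
  forall v w, q (v + w) = q v + q w.
Proof.
move=> sq qmin v w; apply/eqP; rewrite eq_le sq.1/=.
pose S v := [set q (v + t *: w) - t * q w | t in [set t : R | 0 <= t]].
pose r v := inf (S v).
have qZ t u : 0 <= t -> q (t *: u) = t * q u.
  rewrite le_eqVlt => /orP[/eqP<-|]; last exact: sq.2.
  by rewrite scale0r mul0r sublinear0.
have lbS u : has_lbound (S u).
  exists (- q (- u)) => _ [t /= t0 <-].
  have := sq.1 (- u) (u + t *: w); rewrite addKr qZ//; lra.
have rle u t : 0 <= t -> r u <= q (u + t *: w) - t * q w.
  by move=> t0; apply: ge_inf => //; exists t.
have rge u c : (forall t, 0 <= t -> c <= q (u + t *: w) - t * q w) -> c <= r u.
  move=> cS; apply: lb_le_inf; first by exists (q (u + 0 *: w) - 0 * q w), 0 => /=.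
  by move=> _ [t t0 <-]; exact: cS.
have sr : sublinear r.
  split=> [u1 u2|t u t0].
    rewrite -lerBlDr; apply: (rge) => t1 t10; rewrite lerBlDr -lerBlDl.
    apply: (rge) => t2 t20; rewrite lerBlDl.
    have := rle (u1 + u2) (t1 + t2) (addr_ge0 t10 t20).
    rewrite scalerDl addrACA.
    have := sq.1 (u1 + t1 *: w) (u2 + t2 *: w); lra.
  apply/eqP; rewrite eq_le; apply/andP; split.
    rewrite -ler_pdivrMl//; apply: (rge) => s s0; rewrite ler_pdivrMl//.
    have := rle (t *: u) (t * s) (mulr_ge0 (ltW t0) s0).
    by rewrite -scalerA -scalerDr sq.2// mulrBr mulrA.
  apply: (rge) => s s0.
  have st0 : 0 <= t^-1 * s by rewrite mulr_ge0// invr_ge0 ltW.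
  have := rle u _ st0; rewrite -(ler_pM2l t0) => /le_trans; apply.
  rewrite mulrBr -(sq.2 _ (u + _))// scalerDr scalerA !mulrA divff ?gt_eqF// !mul1r.
  by rewrite lexx.
have rq u : r u <= q u.
  by have := rle u 0 (lexx _); rewrite scale0r addr0 mul0r subr0.
have := le_trans (qmin r sr rq v) (rle v 1 ler01).
by rewrite scale1r mul1r lerBrDr.
Qed.

Lemma sublinear_ge_linear p : sublinear p ->
  exists2 l : V -> R^o, linear l & forall v, l v <= p v.
Proof.
move=> /exists_minimal_sublinear[q [sq qp qmin]]; exists q => //.
have qD := minimal_sublinear_additive sq qmin.
have qN v : q (- v) = - q v.
  by have := qD v (- v); rewrite subrr (sublinear0 sq); lra.
move=> t u v; rewrite qD; congr (_ + _).
case: (ltgtP t 0) => [t0|t0|->]; last by rewrite !scale0r sublinear0.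
  rewrite -[t]opprK scaleNr qN sq.2 ?oppr_gt0//.
  by rewrite scaleNr.
by rewrite sq.2.
Qed.

(** Hahn-Banach theorem for a convex relation [K], to be thought of as the
    epigraph of a convex function that is nonnegative at [0] and finite on an
    absorbing set: some linear form lies below it.  Indeed the gauge
    [v |-> inf {s / t | t > 0, K (t v) s}] is finite and sublinear, and any
    linear form below the gauge will do. *)
Lemma convex_relation_ge_linear (K : V -> R -> Prop) :
  (forall u v s r (t : R), 0 < t < 1 -> K u s -> K v r ->
    K (t *: u + (1 - t) *: v) (t * s + (1 - t) * r)) ->
  (forall s, K 0 s -> 0 <= s) ->
  (forall v, exists2 t : R, 0 < t & exists s, K (t *: v) s) ->
  exists2 l : V -> R^o, linear l & forall v s, K v s -> l v <= s.
Proof.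
move=> Kconv K0 Kabs.
pose S v := [set x : R | exists t s, [/\ 0 < t, K (t *: v) s & x = s / t]].
(* Weights [t2 / (t1 + t2)] and [t1 / (t1 + t2)] make the ratios [s1 / t1] and
   [s2 / t2] add up, with common scale [t = t1 t2 / (t1 + t2)]. *)
have comb u v t1 t2 s1 s2 : 0 < t1 -> 0 < t2 -> K (t1 *: u) s1 ->
    K (t2 *: v) s2 -> exists2 t, 0 < t & K (t *: (u + v)) (t * (s1 / t1 + s2 / t2)).
  move=> t10 t20 K1 K2; exists (t1 * t2 / (t1 + t2)).
    by rewrite divr_gt0 ?mulr_gt0 ?addr_gt0.
  have t12 : t1 + t2 != 0 by rewrite gt_eqF ?addr_gt0.
  have := Kconv _ _ _ _ (t2 / (t1 + t2)) _ K1 K2.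
  have -> : 1 - t2 / (t1 + t2) = t1 / (t1 + t2) by field.
  rewrite !scalerA scalerDr [X in _ -> K _ X]mulrDr.
  have -> : t2 / (t1 + t2) * t1 = t1 * t2 / (t1 + t2) by field.
  have -> : t1 / (t1 + t2) * t2 = t1 * t2 / (t1 + t2) by field.
  have -> : t2 / (t1 + t2) * s1 = t1 * t2 / (t1 + t2) * (s1 / t1).
    by field; rewrite t12 gt_eqF.
  have -> : t1 / (t1 + t2) * s2 = t1 * t2 / (t1 + t2) * (s2 / t2).
    by field; rewrite t12 gt_eqF.
  apply; rewrite divr_gt0 ?addr_gt0//= ltr_pdivrMr ?addr_gt0//; lra.
pose p v := inf (S v).
have Sn v : S v !=set0.
  by have [t t0 [s Ks]] := Kabs v; exists (s / t), t, s.
have lbS v : has_lbound (S v).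
  (* A point of [K] over [- v] bounds the ratios over [v] from below, by [K0]. *)
  have [t t0 [s Ks]] := Kabs (- v).
  exists (- (s / t)) => _ [t' [s' [t'0 Ks' ->]]].
  have [t2 t20] := comb _ _ _ _ _ _ t'0 t0 Ks' Ks.
  rewrite subrr scaler0 => /K0; rewrite pmulr_rge0//; lra.
have sp : sublinear p.
  split=> [u v|t v t0].
    rewrite -lerBlDr; apply: lb_le_inf => // _ [t1 [s1 [t10 K1 ->]]].
    rewrite lerBlDr -lerBlDl; apply: lb_le_inf => // _ [t2 [s2 [t20 K2 ->]]].
    rewrite lerBlDl; apply: ge_inf => //.
    have [t t0 Kt] := comb _ _ _ _ _ _ t10 t20 K1 K2.
    exists t, (t * (s1 / t1 + s2 / t2)); split => //; field.
    by rewrite !gt_eqF.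
  apply/eqP; rewrite eq_le; apply/andP; split.
    rewrite -ler_pdivrMl//; apply: lb_le_inf => // _ [t1 [s1 [t10 K1 ->]]].
    rewrite ler_pdivrMl//; apply: ge_inf => //; exists (t1 / t), s1.
    split; first by rewrite divr_gt0.
      by rewrite scalerA divfK ?gt_eqF.
    by field; rewrite !gt_eqF.
  apply: lb_le_inf => // _ [t1 [s1 [t10 K1 ->]]].
  rewrite -ler_pdivlMl//; apply: ge_inf => //; exists (t1 * t), s1.
  split; first by rewrite mulr_gt0.
    by rewrite -scalerA.
  by field; rewrite !gt_eqF.
have [l ll lp] := sublinear_ge_linear sp; exists l => // v s Kvs.
apply: (le_trans (lp v)); apply: ge_inf => //; exists 1, s.
by rewrite scale1r divr1.
Qed.

End hahn_banach.

(** * Linear forms and topological vector spaces *)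

Section linear_forms.
Context {R : realType} {V : lmodType R} (l : V -> R^o).
Hypothesis l_linear : linear l.

Lemma linear_formD u v : l (u + v) = l u + l v.
Proof. by have := l_linear 1 u v; rewrite !scale1r. Qed.

Lemma linear_form0 : l 0 = 0.
Proof. by have := linear_formD 0 0; rewrite addr0; move: (l 0) => z; lra. Qed.

Lemma linear_formZ t v : l (t *: v) = t * l v.
Proof. by have := l_linear t v 0; rewrite linear_form0 !addr0. Qed.

Lemma linear_form_sum n (c : 'I_n -> R) (u : 'I_n -> V) :
  l (\sum_i c i *: u i) = \sum_i c i * l (u i).
Proof.
elim/big_ind2: _ => [|u1 r1 u2 r2 <- <-|i _]; first exact: linear_form0.
  exact: linear_formD.
exact: linear_formZ.
Qed.

End linear_forms.

Section dual_algebra.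
Context {R : realType} {E : preTopologicalLmodType R}.
Implicit Types (a b : dual E).

Lemma dual_linear a : linear a.
Proof. by have := dual_funP a; rewrite inE => -[]. Qed.

Lemma dualDE a b y : (a + b) y = a y + b y :> R.
Proof. by []. Qed.

Lemma dualBE a b y : (a - b) y = a y - b y.
Proof. by []. Qed.

Lemma dual_sumE n (c : 'I_n -> R) (a : 'I_n -> dual E) y :
  (\sum_i c i *: a i) y = \sum_i c i * a i y.
Proof. by elim/big_ind2: _ => // a1 r1 a2 r2 <- <-. Qed.

End dual_algebra.

Section tvs_facts.
Context {R : realType} {X : tvsType R}.

Lemma nbhs0_absorbing (U : set X) (v : X) :
  nbhs 0 U -> exists2 t : R, 0 < t & U (t *: v).
Proof.
move=> U0; have := @scale_continuous R X (0, v) U; rewrite /= scale0r.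
move=> /(_ U0)[] /= B [B1 B2] BU.
have [e /= e0 eB1] := B1.
exists (e / 2); first by rewrite divr_gt0.
apply: (BU (e / 2, v)); split => /=; last exact: nbhs_singleton.
apply: eB1; rewrite /= sub0r normrN gtr0_norm ?divr_gt0//; lra.
Qed.

Lemma linear_bounded_above_continuous (l : X -> R^o) (U : set X) (M : R) :
  linear l -> nbhs 0 U -> (forall v, U v -> l v <= M) -> continuous l.
Proof.
move=> ll U0 lM x.
have M0 : 0 <= M by rewrite -(linear_form0 ll); apply: lM; exact: nbhs_singleton.
have W0 : nbhs 0 (U `&` (-%R @` U)) by apply: filterI => //; exact: nbhs0N.
apply/cvgrPdist_lt => e e0.
(* [M + 1] rather than [M], which may vanish. *)
have r0 : e / (M + 1) != 0 by rewrite gt_eqF// divr_gt0//; lra.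
have := nbhsT x (nbhs0Z r0 W0); apply: filterS => _ [_ [w [Uw [w' Uw' w'w]] <-] <-].
have lw' : l w = - l w' by rewrite -w'w -scaleN1r (linear_formZ ll) mulN1r.
have lw : `|l w| <= M.
  by rewrite ler_norml (lM _ Uw) andbT lw' lerN2 (lM _ Uw').
rewrite (linear_formD ll) (linear_formZ ll) opprD addNKr normrN normrM.
rewrite (gtr0_norm (divr_gt0 _ _))//; last lra.
rewrite mulrAC ltr_pdivrMr; last lra.
rewrite ltr_pM2l//; lra.
Qed.

End tvs_facts.

(** * Splitting the affine minorants of a sum *)

Section convex_functions.
Context {R : realType} {X : tvsType R}.
Implicit Types f g : X -> \bar R.

Lemma convex_efun_epigraph f (x y : X) (a b t : R) :
  convex_efun f -> 0 < t < 1 -> (f x <= a%:E)%E -> (f y <= b%:E)%E ->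
  (f (t *: x + (1 - t) *: y)%R <= (t * a + (1 - t) * b)%R%:E)%E.
Proof.
move=> cf t01 fa fb; apply: (le_trans (cf x y t t01)).
have /andP[t0 t1] := t01.
rewrite [leRHS]EFinD [X in (_ <= X + _)%E]EFinM [X in (_ <= _ + X)%E]EFinM.
apply: leeD; apply: lee_wpmul2l => //.
  by rewrite lee_fin ltW.
by rewrite lee_fin subr_ge0 ltW.
Qed.

Lemma le_epigraph (y : \bar R) (c : R) : y != -oo%E ->
  (forall b, (y <= b%:E)%E -> c <= b) -> (c%:E <= y)%E.
Proof.
by case: y => [r| |] // _ H; [rewrite lee_fin; exact: H | rewrite leey].
Qed.

Lemma convex_efunD f g :
  (forall y, f y != -oo%E) -> (forall y, g y != -oo%E) ->
  convex_efun f -> convex_efun g -> convex_efun (fun y => f y + g y)%E.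
Proof.
move=> fN gN cf cg x y t t01; apply: (le_trans (leeD (cf x y t t01) (cg x y t t01))).
have fgD z : (f z +? g z)%E by case: (f z) (g z) (fN z) (gN z) => [?| |] [?| |].
by rewrite addeACA !muleDr.
Qed.

(** Moreau-Rockafellar splitting.  The relation [K v s] to which the Hahn-Banach
    theorem is applied says that [v = u - y] with [f u <= a], [g y <= b] and
    [s = a + b - xs y - c].  It contains no [(0, s)] with [s < 0] because
    [xs + c] is below [f + g], and continuity of [f] at [x0] makes it absorbing
    and bounds the linear form from above near [0], so that the form is
    continuous. *)
Lemma sum_affine_minorant_split f g (x0 : X) (xs : dual X) (c : R) :
  (forall y, f y != -oo%E) -> (forall y, g y != -oo%E) ->
  convex_efun f -> convex_efun g -> edom g x0 ->
  f x0 \is a fin_num -> {for x0, continuous f} ->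
  (forall y, (xs y + c)%R%:E <= f y + g y)%E ->
  exists (a b : dual X) (c1 c2 : R), [/\ a + b = xs, c1 + c2 = c,
    forall y, ((a y + c1)%R%:E <= f y)%E & forall y, ((b y + c2)%R%:E <= g y)%E].
Proof.
move=> fN gN cf cg gx0 fx0 ctf fgm.
pose K v s := exists u y a b, [/\ (f u <= a%:E)%E, (g y <= b%:E)%E, v = u - y &
  s = a + b - xs y - c].
have [b0 gb0] : exists b, (g x0 <= b%:E)%E.
  move: (gN x0) gx0; rewrite /edom /=; case: (g x0) => [r| |]// _ _.
  by exists r.
pose a0 := fine (f x0) + 1.
have U0 : nbhs (0 : X) [set v | (f (v + x0)%R <= a0%:E)%E].
  have : nbhs x0 [set u | (f u <= a0%:E)%E].
    have : nbhs (f x0) [set z | (z < a0%:E)%E].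
      apply: open_nbhs_nbhs; split; first exact: open_ereal_lt_ereal.
      by rewrite /= -(fineK fx0) lte_fin ltrDl.
    by move=> /ctf; apply: (@filterS _ (nbhs x0)) => u /= /ltW.
  move=> /(nbhsB (- x0)); rewrite addNr; apply: filterS => _ [u fu <-] /=.
  by rewrite addrAC addNr add0r.
have KU v : (f (v + x0)%R <= a0%:E)%E -> K v (a0 + b0 - xs x0 - c).
  by move=> fv; exists (v + x0), x0, a0, b0; rewrite addrK.
have [|s [u [y [a [b [fa gb uy ->]]]]]|v|l ll lK] :=
    @convex_relation_ge_linear R X K.
- move=> _ _ _ _ t t01 [u [y [a [b [fa gb -> ->]]]]] [u' [y' [a' [b' [fa' gb' -> ->]]]]].
  exists (t *: u + (1 - t) *: u'), (t *: y + (1 - t) *: y'), (t * a + (1 - t) * a'),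
    (t * b + (1 - t) * b'); split; try exact: convex_efun_epigraph.
    by rewrite !scalerBr opprD addrACA.
  have xl := dual_linear xs; rewrite (linear_formD xl) !(linear_formZ xl); ring.
- have uy' : u = y by apply/eqP; rewrite -subr_eq0 -uy.
  rewrite uy' in fa.
  have := le_trans (fgm y) (leeD fa gb); rewrite -EFinD lee_fin; lra.
- by have [t t0 fv] := nbhs0_absorbing v U0; exists t => //; eexists; exact: KU.
have ctl : continuous l.
  apply: (linear_bounded_above_continuous ll U0) => v /KU Kv.
  exact: lK Kv.
have lP : l \in @continuous_linear R X by rewrite inE.
pose a := Dual lP.
(* Every affine function [a + z] with [z] between these two families of bounds
   separates [f] from [xs + c - g]; the infimum [c1] of the right-hand sides is
   such a [z]. *)
have lKB u y s r : (f u <= s%:E)%E -> (g y <= r%:E)%E ->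
    xs y + c - a y - r <= s - a u.
  move=> fu gy; have /lK : K (u - y) (s + r - xs y - c) by exists u, y, s, r.
  rewrite (linear_formD ll) -scaleN1r (linear_formZ ll) mulN1r /=; lra.
have fa0 : (f x0 <= a0%:E)%E.
  by have := nbhs_singleton U0; rewrite /= add0r.
pose c1 := inf [set z | exists u s, (f u <= s%:E)%E /\ z = s - a u].
exists a, (xs - a), c1, (c - c1); split.
- by rewrite addrC subrK.
- by rewrite addrC subrK.
- move=> y; apply: le_epigraph => // s fs; rewrite -lerBrDl.
  apply: ge_inf; last by exists y, s.
  by exists (xs x0 + c - a x0 - b0) => _ [u [s' [fu ->]]]; exact: lKB.
- move=> y; apply: le_epigraph => // r gr.
  have : xs y + c - a y - r <= c1.
    apply: lb_le_inf; first by exists (a0 - a x0), x0, a0.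
    by move=> _ [u [s [fu ->]]]; exact: lKB.
  rewrite dualBE; lra.
Qed.

End convex_functions.

(** * Neighborhoods of zero in the weak-star topology *)

Section weak_star_neighborhoods.
Context {R : realType} {E : preTopologicalLmodType R}.

(** The sets containing some box [{z | |z y| < delta for y in s}] form a filter
    along which every evaluation tends to [0], so that it refines the
    neighborhood filter of [0] for the topology of pointwise convergence. *)
Lemma nbhs0_weak_star (U : set (dual E)) : nbhs (0 : weak_star E) U ->
  exists (s : seq E) (delta : R), 0 < delta /\
    forall z : dual E, (forall y, y \in s -> `|z y| < delta) -> U z.
Proof.
pose box (p : seq E * R) := [set z : dual E | forall y, y \in p.1 -> `|z y| < p.2].
pose F := filter_from [set p : seq E * R | 0 < p.2] box.
have FF : Filter F.
  apply: filter_from_filter; first by exists ([::], 1) => /=.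
  move=> [s1 d1] [s2 d2] /= d10 d20; exists (s1 ++ s2, Num.min d1 d2).
    by rewrite /= lt_min d10.
  by move=> z /= zs; split=> y ys; (have := zs y;
    rewrite mem_cat ys ?orbT => /(_ isT); rewrite lt_min => /andP[]).
suff F0 : F --> (0 : weak_star E) by move=> /F0[[s d] /= d0 sU]; exists s, d.
have dF : (@dual_ptws R E @ F) --> (@dual_ptws R E 0).
  apply/cvg_sup => y A [_ [[B oB <-] B0] sBA].
  have /nbhs_ballP[d /= d0 dB] : nbhs (0 : R^o) B by exact: open_nbhs_nbhs.
  exists ([:: y], d) => //= z zy; apply: sBA; apply: dB => /=.
  by rewrite /ball /= sub0r normrN; apply: zy; rewrite mem_head.
move=> A [_ [[B oB <-] B0] sBA].
have /dF : nbhs (@dual_ptws R E 0) B by exact: open_nbhs_nbhs.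
by apply: (@filterS _ F).
Qed.

Lemma nbhs0_weak_star_eval (y : E) (e : R) : 0 < e ->
  nbhs (0 : weak_star E) [set z : dual E | `|z y| < e].
Proof.
move=> e0; have cev : continuous (fun z : weak_star E => (z : dual E) y : R^o).
  move=> z; apply: (@continuous_comp (weak_star E) {ptws E -> R^o} R^o
    (@dual_ptws R E) (fun f => f y)); first exact: initial_continuous.
  exact: (@proj_continuous E (fun=> R^o) y).
have := cev 0 [set r | `|r| < e]; apply.
apply/nbhs_ballP; exists e => //= r.
by rewrite /ball /= sub0r normrN.
Qed.

End weak_star_neighborhoods.

(** * Affine minorants of lower semicontinuous hulls *)

Lemma ereal_lt_between {R : realType} (u v : \bar R) : (u < v)%E ->
  exists r : R, (u < r%:E)%E /\ (r%:E < v)%E.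
Proof.
move: u v => [u| |] [v| |]//=; rewrite ?lte_fin => uv.
- by exists ((u + v) / 2); rewrite !lte_fin; split; lra.
- by exists (u + 1); rewrite lte_fin ltry; split=> //; lra.
- by exists (v - 1); rewrite lte_fin ltNyr; split=> //; lra.
- by exists 0; rewrite ltNyr ltry.
Qed.

Lemma adde_le_of_lt {R : realType} (u v w : \bar R) :
  (-oo < u)%E -> (-oo < v)%E ->
  (forall r s : R, (r%:E < u)%E -> (s%:E < v)%E -> ((r + s)%R%:E <= w)%E) ->
  (u + v <= w)%E.
Proof.
move=> uN vN H; rewrite leNgt; apply/negP => /ereal_lt_between[t [wt tuv]].
suff [r [s [ru sv trs]]] : exists r s : R, [/\ (r%:E < u)%E, (s%:E < v)%E & t = r + s].
  by have := H _ _ ru sv; rewrite -trs leNgt wt.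
move: u v uN vN tuv {H} => [u| |] [v| |]//= _ _; rewrite ?lte_fin => tuv.
- by exists (u - (u + v - t) / 2), (v - (u + v - t) / 2); rewrite !lte_fin; split; lra.
- by exists (u - 1), (t - u + 1); rewrite lte_fin ltry; split=> //; lra.
- by exists (t - v + 1), (v - 1); rewrite lte_fin ltry; split=> //; lra.
- by exists 0, t; rewrite !ltry add0r.
Qed.

Lemma row_norm_ge {R : realType} n (v : 'rV[R]_n) i : `|v 0 i| <= `|v|.
Proof.
have -> : `|v| = mx_norm v by [].
rewrite mx_normrE.
exact: (le_bigmax _ (fun ij => `|v ij.1 ij.2|) (0, i)).
Qed.

Section hull.
Context {R : realType} {X : tvsType R} {tau : topology_on (dual X)}.
Variable (sigma_tau : weak_star_le tau).
Local Notation hull := (wss_lsc_hull sigma_tau).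
Local Notation J := (canonical_embedding sigma_tau).
Implicit Types (h : X -> \bar R) (x : bidual tau) (a : dual X).

Lemma embeddingE y a : J y a = a y.
Proof. by []. Qed.

Lemma hull_embedding_le h y : (hull h (J y) <= h y)%E.
Proof.
apply: ge_ereal_sup => _ [U U0 <-]; apply: ereal_inf_lbound.
by exists y => //=; rewrite subrr; exact: nbhs_singleton U0.
Qed.

(** Evaluation at [a] is continuous on [X^**], hence [a + c] transfers to the
    hull. *)
Lemma hull_ge_affine h a (c : R) x :
  (forall y, ((a y + c)%R%:E <= h y)%E) -> ((x a + c)%R%:E <= hull h x)%E.
Proof.
move=> ah; apply/lee_subgt0Pr => e e0.
apply: (@le_trans _ _ (ereal_inf [set h y | y in [set y | `|(J y - x)%R a| < e]])).
  apply: le_ereal_inf_tmp => _ [y /= xya <-]; apply: le_trans (ah y).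
  have : `|a y - x a| < e by exact: xya.
  rewrite ltr_norml -EFinB lee_fin; lra.
apply: ereal_sup_ubound; exists [set z : bidual tau | `|z a| < e] => //.
exact: (@nbhs0_weak_star_eval R (with_topology tau)).
Qed.

(** Fenchel-Moreau theorem, in the form of affine minorants of [h] whose value
    at [x] is [r].  Some basic neighborhood of [x], given by finitely many
    functionals, contains no point of [X] where [h] is less than [r].  The
    separation takes place in the finite-dimensional space of the values [T y]
    of [y - x] at these functionals, between the epigraph of the image of [h]
    under [T] and the hypograph of the penalty [w |-> r - k |w|].  The finite
    penalty replaces the neighborhood itself, which the domain of [h] may miss:
    the linear form obtained is then never vertical. *)
Lemma hull_gt_affine_minorant h x (r : R) (y0 : X) :
  convex_efun h -> (forall y, h y != -oo%E) -> has_continuous_affine_minorant h ->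
  edom h y0 -> (r%:E < hull h x)%E ->
  exists a, forall y, ((a y + (r - x a))%R%:E <= h y)%E.
Proof.
move=> ch hN [ys [c hys]] hy0 /ereal_sup_gt[_ [U U0 <-] rU].
have [s [d [d0 sU]]] := @nbhs0_weak_star R (with_topology tau) U U0.
have hbox y b : (h y <= b%:E)%E ->
    (forall z : dual X, z \in (s : seq (dual X)) -> `|z y - x z| < d) -> r <= b.
  move=> hb zy; rewrite -lee_fin; apply: le_trans hb; apply: ltW.
  apply: (lt_le_trans rU); apply: ereal_inf_lbound; exists y => //=.
  by apply: sU => z zs; exact: zy.
(* The slope [ys] of the given minorant is added to the functionals defining
   the neighborhood, in position [0], so that [|T y|] controls [ys y - x ys]. *)
pose n := (size s).+1.
pose F (i : 'I_n) : dual X := nth ys (ys :: s : seq (dual X)) i.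
pose T y : 'rV[R]_n := \row_i (F i y - x (F i)).
(* Inside the neighborhood [h] is at least [r]; outside it [|T y| >= d], and the
   minorant [ys + c] loses at most [|T y|], which [k] compensates. *)
pose k := 1 + `|r - c - x ys| / d.
have k0 : 0 <= k by rewrite addr_ge0// divr_ge0// ltW.
have T0 y : `|ys y - x ys| <= `|T y|.
  by have := row_norm_ge (T y) 0; rewrite mxE.
have pen y b : (h y <= b%:E)%E -> r <= b + k * `|T y|.
  move=> hb; have [Td|Td] := ltP `|T y| d.
    apply: (@le_trans _ _ b); last by rewrite lerDl mulr_ge0.
    apply: hbox hb _ => z zs; apply: le_lt_trans Td.
    have zi : ((index z (s : seq (dual X))).+1 < n)%N by rewrite ltnS index_mem.
    by have := row_norm_ge (T y) (Ordinal zi); rewrite mxE /F /= nth_index.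
  have := le_trans (hys y) hb; rewrite lee_fin => yb.
  have : `|r - c - x ys| <= (k - 1) * `|T y|.
    have -> : k - 1 = `|r - c - x ys| / d by rewrite /k; ring.
    rewrite mulrAC ler_pdivlMr//.
    by rewrite ler_wpM2l.
  have := T0 y; rewrite !ler_norml mulrBl mul1r; lra.
have [b0 hb0] : exists b, (h y0 <= b%:E)%E.
  move: (hN y0) hy0; rewrite /edom /=; case: (h y0) => [b| |]// _ _.
  by exists b.
pose K v s := exists y w b, [/\ (h y <= b%:E)%E, v = T y - w &
  b + k * `|w| - r <= s].
have TD t y y' : T (t *: y + (1 - t) *: y') = t *: T y + (1 - t) *: T y'.
  apply/rowP => i; have Fl := dual_linear (F i).
  by rewrite !mxE (linear_formD Fl) !(linear_formZ Fl); ring.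
have [|e [y [w [b [hb /esym/eqP + wbe]]]]|v|l ll lK] :=
    @convex_relation_ge_linear R 'rV[R]_n K.
- move=> _ _ e1 e2 t t01 [y [w [b [hb -> be1]]]] [y' [w' [b' [hb' -> be2]]]].
  exists (t *: y + (1 - t) *: y'), (t *: w + (1 - t) *: w'), (t * b + (1 - t) * b').
  split; first exact: convex_efun_epigraph.
    by rewrite TD !scalerBr opprD addrACA.
  have /andP[t0 t1] := t01.
  have t1' : 0 <= 1 - t by lra.
  have : `|t *: w + (1 - t) *: w'| <= t * `|w| + (1 - t) * `|w'|.
    apply: (le_trans (ler_normD _ _)).
    by rewrite !normrZ !ger0_norm// ltW.
  move=> /(ler_wpM2l k0).
  have := ler_wpM2l (ltW t0) be1.
  have := ler_wpM2l t1' be2; lra.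
- by rewrite subr_eq0 => /eqP Tyw; apply: le_trans wbe; rewrite -Tyw subr_ge0 pen.
- exists 1 => //; exists (b0 + k * `|T y0 - v| - r), y0, (T y0 - v), b0.
  by rewrite scale1r opprB addrC subrK.
(* [l v] is the sum of the [v_i l(e_i)], so [y |-> l (T y)] is affine, with slope
   in the span of the [F i] and value [0] at [x]; take [w = 0] in [K]. *)
exists (\sum_i l 'e_i *: F i) => y; apply: le_epigraph => // b hb.
have /lK : K (T y) (b - r).
  by exists y, 0, b; rewrite subr0 normr0 mulr0 addr0.
have -> : l (T y) = (\sum_i l 'e_i *: F i : dual X) y - x (\sum_i l 'e_i *: F i).
  rewrite dual_sumE (linear_form_sum (dual_linear x)) -sumrB.
  rewrite [in LHS](row_sum_delta (T y)) (linear_form_sum ll).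
  by apply: eq_bigr => i _; rewrite mxE mulrC mulrBr.
lra.
Qed.

End hull.

(** * The hull of a sum *)

Section hull_sum.
Context {R : realType} {X : tvsType R} {tau : topology_on (dual X)}.
Variable (sigma_tau : weak_star_le tau).
Local Notation hull := (wss_lsc_hull sigma_tau).
Variables (f g : X -> \bar R) (x0 : X).
Hypothesis fN : forall y, f y != -oo%E.
Hypothesis gN : forall y, g y != -oo%E.
Hypothesis f_convex : convex_efun f.
Hypothesis g_convex : convex_efun g.
Hypothesis f_minorant : has_continuous_affine_minorant f.
Hypothesis g_minorant : has_continuous_affine_minorant g.
Hypothesis gx0 : edom g x0.
Hypothesis fx0 : f x0 \is a fin_num.
Hypothesis f_cont : {for x0, continuous f}.

(** Both inequalities compare affine minorants: those of [f] and [g] add up to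
    minorants of [f + g], and those of [f + g] split. *)
Lemma wss_lsc_hullD (x : bidual tau) :
  hull (fun y => f y + g y)%E x = (hull f x + hull g x)%E.
Proof.
have [a1 [k1 fa1]] := f_minorant; have [a2 [k2 ga2]] := g_minorant.
have fx0' : edom f x0 by rewrite /edom /= -(fineK fx0) ltry.
have fgx0 : edom (fun y => f y + g y)%E x0 by rewrite /edom /= lte_add_pinfty.
have fgN y : (f y + g y)%E != -oo%E.
  by case: (f y) (g y) (fN y) (gN y) => [?| |] [?| |].
apply/eqP; rewrite eq_le; apply/andP; split; last first.
  apply: adde_le_of_lt.
  - by apply: lt_le_trans (hull_ge_affine sigma_tau x fa1); rewrite ltNyr.
  - by apply: lt_le_trans (hull_ge_affine sigma_tau x ga2); rewrite ltNyr.
  move=> r s rf sg.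
  have [a fa] := hull_gt_affine_minorant f_convex fN f_minorant fx0' rf.
  have [b gb] := hull_gt_affine_minorant g_convex gN g_minorant gx0 sg.
  have -> : r + s = x (a + b) + (r - x a + (s - x b)).
    have xl := dual_linear x; rewrite (linear_formD xl); ring.
  apply: hull_ge_affine => y; apply: le_trans (leeD (fa y) (gb y)).
  rewrite -EFinD lee_fin dualDE; lra.
apply: contraT; rewrite -ltNge => lt_hull.
have [r [rlt ltr]] := ereal_lt_between lt_hull.
have [xs fgxs] : exists a : dual X, forall y, ((a y + (r - x a))%R%:E <= f y + g y)%E.
  apply: hull_gt_affine_minorant fgx0 ltr => //; first exact: convex_efunD.
  exists (a1 + a2), (k1 + k2) => y; apply: le_trans (leeD (fa1 y) (ga2 y)).
  rewrite -EFinD lee_fin dualDE; lra.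
have [a [b [c1 [c2 [abxs c12 fa gb]]]]] :=
  sum_affine_minorant_split fN gN f_convex g_convex gx0 fx0 f_cont fgxs.
have := le_lt_trans
  (leeD (hull_ge_affine sigma_tau x fa) (hull_ge_affine sigma_tau x gb)) rlt.
have : x xs = x a + x b by rewrite -abxs; exact: (linear_formD (dual_linear x)).
rewrite -EFinD lte_fin; lra.
Qed.

End hull_sum.

(** * Approximate subdifferentials *)

Section subdifferentials.
Context {R : realType} {X : tvsType R} {tau : topology_on (dual X)}.
Implicit Types (h : bidual tau -> \bar R) (x : bidual tau).

Lemma conjugate_leP h (xs : dual X) (m : R) :
  (conjugate h xs <= m%:E)%E <-> forall z : bidual tau, ((z xs - m)%R%:E <= h z)%E.
Proof.
have key (z : bidual tau) : ((z xs)%:E - h z <= m%:E)%E = ((z xs - m)%R%:E <= h z)%E.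
  case: (h z) => [t| |]; last by [].
    by rewrite -EFinB !lee_fin lerBlDr lerBlDl.
  by rewrite leey leNye.
split=> [cm z|hm].
  by rewrite -key; apply: le_trans cm; apply: ereal_sup_ubound; exists z.
by apply: ge_ereal_sup => _ [z _ <-]; rewrite key.
Qed.

(** The variational form of the subdifferential, free of conjugates. *)
Lemma subdifferentialP (eps : R) h x (xs : dual X) :
  subdifferential eps h x xs <-> h x \is a fin_num /\
    forall z : bidual tau, ((z xs - x xs + fine (h x) - eps)%R%:E <= h z)%E.
Proof.
rewrite /subdifferential /=.
suff key : h x \is a fin_num -> (conjugate h xs + h x <= (x xs + eps)%:E)%E <->
    forall z : bidual tau, ((z xs - x xs + fine (h x) - eps)%R%:E <= h z)%E.
  by split=> -[hx] /(key hx).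
move=> hx; rewrite -leeBrDr// -(fineK hx) -EFinB; split.
  move=> /conjugate_leP H z; apply: le_trans (H z); rewrite lee_fin fineK//; lra.
by move=> H; apply/conjugate_leP => z; apply: le_trans (H z); rewrite lee_fin; lra.
Qed.

End subdifferentials.

(** * The subdifferential of a sum *)

Theorem theorem8 (R : realType) (X : tvsType R)
    (X_hausdorff : hausdorff_space X)
    (tau : topology_on (dual X))
    (tau_lc : locally_convex_topology tau)
    (sigma_tau : weak_star_le tau)
    (tau_beta : le_strong_dual tau)
    (f g : X -> \bar R)
    (f_proper : forall x, f x != -oo%E) (g_proper : forall x, g x != -oo%E)
    (f_convex : convex_efun f) (g_convex : convex_efun g)
    (f_minorant : has_continuous_affine_minorant f)
    (g_minorant : has_continuous_affine_minorant g)
    (fg_qualification : exists2 x0 : X, edom g x0 &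
      f x0 \is a fin_num /\ {for x0, continuous f})
    (x : bidual tau) (eps : R) (eps_ge0 : 0 <= eps) :
  let hull := wss_lsc_hull sigma_tau in
  subdifferential eps (hull (fun y => f y + g y)%E) x
    = subdifferential eps (fun z => hull f z + hull g z)%E x
  /\
  subdifferential eps (fun z => hull f z + hull g z)%E x
    = \bigcup_(e in [set e : R * R | [/\ 0 <= e.1, 0 <= e.2 & e.1 + e.2 = eps]])
        [set a + b | a in subdifferential e.1 (hull f) x
                   & b in subdifferential e.2 (hull g) x].
Proof.
have [x0 gx0 [fx0 f_cont]] := fg_qualification => hull.
have hullE : hull (fun y => f y + g y)%E = (fun z => hull f z + hull g z)%E.
  by apply/funext => z; exact: wss_lsc_hullD gx0 fx0 f_cont z.
split; first by rewrite hullE.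
apply/seteqP; split=> xs.
  move=> /subdifferentialP[]; set v := fine _; rewrite fin_numD => /andP[Fx Gx] H.
  have vE : v = fine (hull f x) + fine (hull g x) by rewrite /v fineD.
  (* On [X] the hulls are below [f] and [g], so the subgradient inequality gives
     an affine minorant of [f + g]. *)
  have fgxs y : ((xs y + (v - x xs - eps))%R%:E <= f y + g y)%E.
    apply: le_trans (leeD (hull_embedding_le sigma_tau f y)
      (hull_embedding_le sigma_tau g y)); apply: le_trans (H _).
    rewrite lee_fin embeddingE; lra.
  have [a [b [c1 [c2 [abxs c12 fa gb]]]]] := sum_affine_minorant_split
    f_proper g_proper f_convex g_convex gx0 fx0 f_cont fgxs.
  have xab : x xs = x a + x b by rewrite -abxs; exact: (linear_formD (dual_linear x)).
  have fa' := hull_ge_affine sigma_tau _ fa; have gb' := hull_ge_affine sigma_tau _ gb.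
  have fax : x a + c1 <= fine (hull f x) by rewrite -lee_fin fineK.
  have gbx : x b + c2 <= fine (hull g x) by rewrite -lee_fin fineK.
  (* [e] is the gap at [x] between [F] and its affine minorant [a + c1]; the gap
     of [G] is at most [eps - e]. *)
  pose e := fine (hull f x) - x a - c1.
  exists (e, eps - e) => /=.
    by split; rewrite ?subrKC// /e; lra.
  exists a.
    apply/subdifferentialP; split=> // z; apply: le_trans (fa' z).
    rewrite lee_fin /e /=; lra.
  exists b => //.
  apply/subdifferentialP; split=> // z; apply: le_trans (gb' z).
  rewrite lee_fin /e /=; lra.
move=> [[e1 e2] /= [_ _ e12] [a /subdifferentialP[Fx fa] [b /subdifferentialP[Gx gb] <-]]].
apply/subdifferentialP; split=> [|z]; first by rewrite fin_numD Fx.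
apply: le_trans (leeD (fa z) (gb z)); rewrite -EFinD lee_fin fineD//.
by rewrite !(linear_formD (dual_linear _)); lra.
Qed.
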